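(* Let $c_n$ be the number of $FF$-equivalence classes of the set $\mathcal{L}_n$ of Łukasiewicz paths of length $n$. Then $$\sum_{n\geq0}c_nx^n=\frac{1-3x+4x^2-5x^3+7x^4-7x^5+6x^6-3x^7+x^8}{(1-2x+x^2-x^3)(1-x)^2}.$$
   Context: A Łukasiewicz path of length $n$ is a sequence of $n$ steps from $\{(1,i): i\geq -1\}$ starting at $(0,0)$, ending at $(n,0)$ and never going below the $x$-axis. Write $D=(1,-1)$, $F=(1,0)$, $U_k=(1,k)$ for $k\geq1$. Steps are numbered $1,\dots,n$; an occurrence of $FF$ is at position $i$ if its first step is the $i$-th step. Two Łukasiewicz paths of the same length are $FF$-equivalent if the sets of occurrence positions of $FF$ in them are identical. *)

(* Defs.v *)
From HB Require Import structures.
From mathcomp Require Import all_boot all_order all_algebra.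

Set Implicit Arguments.
Unset Strict Implicit.
Unset Printing Implicit Defensive.

Import Order.TTheory GRing.Theory Num.Theory.
Local Open Scope ring_scope.

(* The step (1, i) is encoded by the integer i, so that D, F and U_k are -1, 0
   and k.  The k-th vertex of the path with steps s is (k, height s k). *)
Definition height (s : seq int) (k : nat) : int := \sum_(a <- take k s) a.

Definition is_lukasiewicz (s : seq int) : bool :=
  [&& all (fun a : int => -1 <= a) s,
      height s (size s) == 0
    & all (fun k => 0 <= height s k) (iota 0 (size s).+1)].

Record lpath (n : nat) := LPath {
  steps :> n.-tuple int;
  stepsP : is_lukasiewicz steps
}.

HB.instance Definition _ n := [isSub for @steps n].
HB.instance Definition _ n := [Countable of lpath n by <:].

(* Finiteness: every step of a path of length n lies between -1 and n - 1. *)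

Lemma sum_ge_size (s : seq int) :
  all (fun a : int => -1 <= a) s -> - (size s)%:Z <= \sum_(a <- s) a.
Proof.
elim: s => [|a s IHs] /=; first by rewrite big_nil oppr0.
case/andP=> ha /IHs hs; rewrite big_cons -addn1 PoszD opprD addrC.
exact: lerD.
Qed.

Lemma step_bound (s : seq int) (a : int) :
  is_lukasiewicz s -> a \in s -> -1 <= a < (size s)%:Z.
Proof.
case/and3P=> hs /eqP h0 /allP hk ain; rewrite (allP hs) //=.
case/splitPr: s / ain hs h0 hk => s1 s2 hs h0 hk.
have h1 : 0 <= \sum_(b <- s1) b.
  have := hk (size s1); rewrite /height take_size_cat //; apply.
  by rewrite mem_iota size_cat add0n /= ltnS leq_addr.
have h2 : - (size s2)%:Z <= \sum_(b <- s2) b.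
  by apply: sum_ge_size; move: hs; rewrite all_cat /= => /and3P[].
move: h0; rewrite /height take_size big_cat big_cons /= => h0.
have -> : a = - (\sum_(b <- s1) b) - \sum_(b <- s2) b.
  by apply/eqP; rewrite -subr_eq0 -[X in _ == X]h0 opprD !opprK addrCA.
apply: (@le_lt_trans _ _ (size s2)%:Z).
  by rewrite -[leRHS]add0r lerD // ?oppr_le0 // lerNl.
by rewrite ltz_nat size_cat /= addnS ltnS leq_addl.
Qed.

Definition lpath_code n (p : lpath n) : n.-tuple 'I_n.+1 :=
  map_tuple (fun a : int => inord (absz (a + 1))) p.

Definition lpath_decode n (t : n.-tuple 'I_n.+1) : option (lpath n) :=
  insub (map_tuple (fun i : 'I_n.+1 => (i : nat)%:Z - 1) t).

Lemma lpath_codeK n : pcancel (@lpath_code n) (@lpath_decode n).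
Proof.
move=> p; rewrite /lpath_decode -[RHS](valK p); congr insub.
apply: val_inj; rewrite /= -map_comp -[RHS]map_id.
apply/eq_in_map => a ain /=.
have /andP[ha1 ha2] := step_bound (stepsP p) ain.
rewrite size_tuple in ha2.
have hpos : 0 <= a + 1 by rewrite -lerBlDr sub0r.
rewrite inordK; first by rewrite gez0_abs // addrK.
by rewrite -ltz_nat gez0_abs // -addn1 PoszD ltrD2r.
Qed.

HB.instance Definition _ n : isFinite (lpath n) := PCanIsFinite (@lpath_codeK n).

(* Steps are numbered from 1: step i is the entry of index i.-1. *)
Definition FF_positions n (p : lpath n) : {set 'I_n.+1} :=
  [set i : 'I_n.+1 |
     [&& (0 < i)%N, (i < n)%N, p`_i.-1 == 0 & p`_i == 0]].

Definition FF_equiv n : rel (lpath n) :=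
  [rel p q | FF_positions p == FF_positions q].

Definition FF_classes n : {set {set lpath n}} :=
  equivalence_partition (@FF_equiv n) [set: lpath n].

(* Formal power series are given by their coefficient sequences. *)
Definition series_mul (R : nzRingType) (a b : nat -> R) (n : nat) : R :=
  \sum_(i < n.+1) a i * b (n - i)%N.

(* sum_n a_n x^n = P / Q in R[[x]]: Q is invertible there, which amounts to its
   constant term being a unit, and Q * (sum_n a_n x^n) = P. *)
Definition is_series_of_fraction (R : comUnitRingType)
    (a : nat -> R) (P Q : {poly R}) : Prop :=
  Q`_0 \is a GRing.unit /\ forall n, series_mul (fun i => Q`_i) a n = P`_n.

Lemma is_series_of_fraction_uniq (R : comUnitRingType)
    (a b : nat -> R) (P Q : {poly R}) :
  is_series_of_fraction a P Q -> is_series_of_fraction b P Q -> a =1 b.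
Proof.
case=> uQ ha [_ hb] n; elim/ltn_ind: n => n IHn.
have := ha n; rewrite -(hb n) /series_mul !big_ord_recl /= subn0.
under eq_bigr => i _ do rewrite IHn ?ltn_subrL ?(leq_ltn_trans _ (ltn_ord i)) //.
by move/addIr/(mulrI uQ).
Qed.

(* Main.v *)
Require Import Defs.
From mathcomp Require Import all_boot all_order all_algebra.
From mathcomp Require Import zify ring.

Set Implicit Arguments.
Unset Strict Implicit.
Unset Printing Implicit Defensive.

Import GRing.Theory.
Local Open Scope ring_scope.

(* Record the flat steps of a path by a binary word. The FF-positions determine,
   and are determined by, the opening of that word, which keeps only the runs of
   true of length at least 2. A word comes from a path if and only if it does not
   contain exactly one false. So, for n <> 1, the classes correspond to the words
   of length n whose runs of true all have length at least 2 and which do not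
   contain exactly one false. Without the last condition the number a_n of words
   satisfies a_{n+3} = 2 a_{n+2} - a_{n+1} + a_n, and exactly n - 2 of these words
   contain one false when n >= 4. *)

(** * Openings of binary words *)

(* The letter before w is prev; past the end of w, the letter is false. *)
Fixpoint opening (prev : bool) (w : bitseq) : bitseq :=
  if w is b :: w' then (b && (prev || head false w')) :: opening b w' else [::].

Lemma size_opening b w : size (opening b w) = size w.
Proof. by elim: w b => //= c w IHw b; rewrite IHw. Qed.

Lemma nth_opening b w i :
  nth false (opening b w) i =
  nth false w i && (nth false (b :: w) i || nth false w i.+1).
Proof. by elim: w b i => [|c w IHw] b [|i] //=; rewrite ?nth_nil ?IHw // nth0. Qed.

(** A true letter survives when it has a true neighbour; that neighbour then survives too, so a
    second pass removes nothing. *)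
Lemma opening_idem w : opening false (opening false w) = opening false w.
Proof.
apply: (@eq_from_nth _ false); rewrite !size_opening // => i _.
rewrite nth_opening; case: i => [|i] /=; rewrite !nth_opening /=.
  by case: (nth false w 0); case: (nth false w 1).
by do 4!case: nth.
Qed.

Lemma opening_stable_cons b c w :
  (opening b (c :: w) == c :: w) =
  (c ==> (b || head false w)) && (opening c w == w).
Proof. by rewrite /= eqseq_cons; case: c; rewrite //= eqb_id. Qed.

Lemma opening_nseq_true b n : b || (n != 1)%N ->
  opening b (nseq n true) = nseq n true.
Proof.
elim: n b => [|n IHn] b //= hb; rewrite IHn //.
by case: n hb {IHn} => [|n] /=; rewrite ?orbF ?orbT // => ->.
Qed.

Lemma count_negb_opening b w : (count negb w <= count negb (opening b w))%N.
Proof. by elim: w b => //= c w IHw b; apply: leq_add => //; case: c. Qed.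

Lemma count_negb_eq0 w : (count negb w == 0)%N = (w == nseq (size w) true).
Proof. by elim: w => //= -[] w IHw. Qed.

(** Opening never turns false into true, so two or more false letters persist. A word without false
    is fixed, except in length 1, where its opening is [[:: false]]. *)
Lemma count_negb_opening_neq1 w : (size w != 1)%N ->
  (count negb w != 1)%N -> (count negb (opening false w) != 1)%N.
Proof.
move=> sz1 w1; case: (posnP (count negb w)) => [/eqP w0|w_gt0].
  move: w0 w1; rewrite count_negb_eq0 => /eqP ->.
  by rewrite opening_nseq_true.
have := count_negb_opening false w; lia.
Qed.

(** * FF-equivalence through flat steps *)

Definition flats n (p : lpath n) : n.-tuple bool :=
  [tuple of map (fun a : int => a == 0) p].

Lemma nth_flats n (p : lpath n) i :
  (i < n)%N -> nth false (flats p) i = (p`_i == 0).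
Proof. by move=> ltin; rewrite (nth_map 0) ?size_tuple. Qed.

(** Occurrences of FF are pairs of adjacent true letters. The opening keeps exactly the letters
    lying in such pairs, and it has the same pairs as the word. *)
Lemma FF_equivE n (p q : lpath n) :
  FF_equiv p q = (opening false (flats p) == opening false (flats q)).
Proof.
have flats_out (r : lpath n) i : (n <= i)%N -> nth false (flats r) i = false.
  by move=> leni; rewrite nth_default ?size_tuple.
apply/eqP/eqP => [/setP eqS|eq_op].
  have eqFF i : nth false (flats p) i && nth false (flats p) i.+1 =
                nth false (flats q) i && nth false (flats q) i.+1.
    (* No pair starts at the last letter, since [nth] returns false past the end. *)
    case: (ltnP i.+1 n) => [lti|lei]; last first.
      by rewrite !(flats_out _ i.+1) // !andbF.
    rewrite !nth_flats ?(ltnW lti) //.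
    by have := eqS (inord i.+1); rewrite !inE inordK ?(leq_trans lti) //= lti.
  apply: (@eq_from_nth _ false); rewrite !size_opening ?size_tuple // => i _.
  rewrite !nth_opening !andb_orr eqFF; congr orb.
  by case: i => [|i]; rewrite ?andbF // andbC [RHS]andbC [LHS]eqFF.
have FF_opening w i : nth false w i && nth false w i.+1 =
    nth false (opening false w) i && nth false (opening false w) i.+1.
  by rewrite !nth_opening /=; do 3!case: nth; rewrite ?orbT.
apply/setP => -[[|i] ltin]; rewrite !inE //=.
case: (ltnP i.+1 n) => //= lti.
rewrite -!(nth_flats _ lti) -!(nth_flats _ (ltnW lti)).
by rewrite FF_opening [RHS]FF_opening eq_op.
Qed.

(** * Paths with prescribed flat steps *)

(* The first step that is not flat goes up by the number of the others, which
   all go down. The step is flat after all if there are no others, hence the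
   hypothesis of flat_unflat. *)
Fixpoint unflat (w : bitseq) : seq int :=
  if w is b :: w' then
    if b then 0 :: unflat w'
    else (count negb w')%:Z :: [seq if c then 0 else -1 | c <- w']
  else [::].

Lemma size_unflat w : size (unflat w) = size w.
Proof. by elim: w => //= -[] w IHw /=; rewrite ?IHw ?size_map. Qed.

Lemma unflat_ge w : all (fun a : int => -1 <= a) (unflat w).
Proof.
elim: w => //= -[] w IHw //=; rewrite all_map.
by apply/allP => -[].
Qed.

Lemma height_down w k :
  height [seq if c then 0 else -1 | c <- w] k = - (count negb (take k w))%:Z.
Proof.
rewrite /height -map_take big_map.
elim: (take k w) => [|c u IHu]; first by rewrite big_nil.
by rewrite big_cons IHu /=; case: c; lia.
Qed.

Lemma height_cons a s k : height (a :: s) k.+1 = a + height s k.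
Proof. by rewrite /height /= big_cons. Qed.

Lemma height0 s : height s 0 = 0.
Proof. by rewrite /height take0 big_nil. Qed.

(** Once the up step is taken, the height is the number of false letters still to be read. *)
Lemma height_unflat_ge0 w k : 0 <= height (unflat w) k.
Proof.
elim: w k => [|b w IHw] [|k]; rewrite ?height0 //; first by rewrite /height big_nil.
case: b; rewrite height_cons ?add0r //.
rewrite height_down.
have := count_cat negb (take k w) (drop k w); rewrite cat_take_drop; lia.
Qed.

Lemma height_unflat_size w : height (unflat w) (size w) = 0.
Proof.
elim: w => [|b w IHw]; rewrite ?height0 //=.
by case: b; rewrite height_cons ?add0r // height_down take_size subrr.
Qed.

Lemma unflat_lukasiewicz w : is_lukasiewicz (unflat w).
Proof.
apply/and3P; split; first exact: unflat_ge.
  by rewrite size_unflat height_unflat_size.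
by apply/allP => k _; apply: height_unflat_ge0.
Qed.

Lemma flat_unflat w : (count negb w != 1)%N ->
  [seq a == 0 | a : int <- unflat w] = w.
Proof.
elim: w => //= -[] w IHw /= w1; first by rewrite IHw.
congr cons; first by apply/negbTE; lia.
by rewrite -map_comp -[RHS]map_id; apply: eq_map => -[].
Qed.

(** A single nonzero step would equal the final height, which is 0. *)
Lemma count_flats_neq1 n (p : lpath n) : (count negb (flats p) != 1)%N.
Proof.
case: p => p pP; have /and3P[_ /eqP + _] := pP.
rewrite /height take_size /=; move: (tval p) => s.
elim: s => [|a s IHs] //=; rewrite big_cons.
case: (eqVneq a 0) => [->|a0] /=; first by rewrite add0r; apply: IHs.
rewrite add1n eqSS; apply: contra_eqN; rewrite count_negb_eq0 size_map => /eqP eqs.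
rewrite big_seq big1 ?addr0 // => b bs; apply/eqP.
have : (b == 0) \in map (fun a : int => a == 0) s by apply: map_f.
by rewrite eqs mem_nseq => /andP[_ /eqP].
Qed.

(** * From classes to stable words *)

(** The classes are the fibres of [f] over its image, and fibres over distinct attained values
    differ. *)
Lemma card_equivalence_partition (T rT : finType) (f : T -> rT) (e : rel T) :
  (forall x y, e x y = (f x == f y)) ->
  #|equivalence_partition e [set: T]| = #|f @: [set: T]|.
Proof.
move=> eE; rewrite -(@card_in_imset _ _ (fun u => [set y | f y == u])); last first.
  move=> _ _ /imsetP[x _ ->] /imsetP[y _ ->] /setP/(_ x).
  by rewrite !inE eqxx => /esym/eqP.
congr #|pred_of_set _|; rewrite -imset_comp; apply: eq_imset => x /=.
by apply/setP => y; rewrite !inE eE eq_sym.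
Qed.

(** The preceding letter [b] and the condition [Q] are parameters so that removing the first letter
    stays within the family: deleting a false replaces [Q] by [Q \o S]. *)
Definition stable_words (b : bool) (Q : pred nat) n : {set n.-tuple bool} :=
  [set t : n.-tuple bool | (opening b t == t) && Q (count negb t)].

(** Classes correspond to openings of flat words. These are stable by idempotence; conversely a
    stable word with a number of false other than one is its own opening and comes from the path
    [unflat t]. *)
Lemma card_FF_classes n : (n != 1)%N ->
  #|FF_classes n| = #|stable_words false (fun k => k != 1)%N n|.
Proof.
move=> n1.
have sz (p : lpath n) : size (opening false (flats p)) == n.
  by rewrite size_opening size_tuple.
rewrite /FF_classes (card_equivalence_partition (f := fun p => Tuple (sz p))).
  apply: eq_card => t; rewrite inE.
  apply/imsetP/andP => [[p _ ->]|[/eqP st t1]].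
    by rewrite /= opening_idem count_negb_opening_neq1 ?size_tuple ?count_flats_neq1.
  have szu : size (unflat t) == n by rewrite size_unflat size_tuple.
  have uP : is_lukasiewicz (Tuple szu) by apply: unflat_lukasiewicz.
  by exists (LPath uP) => //; apply: val_inj; rewrite /= flat_unflat.
by move=> p q; rewrite FF_equivE.
Qed.

(** Length 1 is apart: the opening of the flat word of the path F is [[:: false]], with exactly one
    false. *)
Lemma card_FF_classes1 : #|FF_classes 1| = 1%N.
Proof.
have flP : is_lukasiewicz [tuple 0 : int] by apply: (unflat_lukasiewicz [:: true]).
rewrite /FF_classes (card_equivalence_partition (f := fun _ => tt)).
  rewrite (_ : _ @: _ = [set tt]) ?cards1 //; apply/setP => -[]; rewrite inE eqxx.
  by apply/imsetP; exists (LPath flP).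
have op1 (t : 1.-tuple bool) : opening false t = [:: false].
  by case/tupleP: t => b t; rewrite (tuple0 t) /= andbF.
by move=> p q; rewrite FF_equivE eqxx !op1 eqxx.
Qed.

(** * Enumeration of stable words *)

Lemma card_tuple_cons n (P : pred bitseq) :
  #|[set t : n.+1.-tuple bool | P t]| =
  (#|[set t : n.-tuple bool | P (true :: t)]| +
   #|[set t : n.-tuple bool | P (false :: t)]|)%N.
Proof.
have injc b : injective (fun t : n.-tuple bool => cons_tuple b t).
  by move=> t u /(congr1 val) [] /val_inj.
rewrite -(card_imset _ (injc true)) -(card_imset _ (injc false)).
rewrite -cardsUI [X in (_ + #|pred_of_set X|)%N](_ : _ = set0) ?cards0 ?addn0.
  apply: eq_card => t; rewrite !inE.
  apply/idP/orP => [|[] /imsetP[u + ->]]; rewrite ?inE //.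
  case/tupleP: t => b t Pt; case: b Pt => Pt; [left|right];
  by apply/imsetP; exists t; rewrite ?inE.
apply/setP => t; rewrite !inE; apply/negP => /andP[].
by move=> /imsetP[u _ ->] /imsetP[v _ /(congr1 val)].
Qed.

Lemma card_stable_true0 Q : #|stable_words true Q 0| = Q 0%N.
Proof.
rewrite /stable_words; case Q0: (Q 0%N).
  rewrite (_ : [set _ | _] = setT) ?cardsT ?card_tuple //.
  by apply/setP => t; rewrite !inE tuple0 /= Q0.
rewrite (_ : [set _ | _] = set0) ?cards0 //.
by apply/setP => t; rewrite !inE tuple0 /= Q0.
Qed.

Lemma card_stable_false0 Q : #|stable_words false Q 0| = Q 0%N.
Proof.
rewrite -card_stable_true0; apply: eq_card => t.
by rewrite !inE tuple0.
Qed.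

Lemma card_stable_cons b Q n :
  #|stable_words b Q n.+1| =
  (#|[set t : n.-tuple bool |
       (opening b (true :: t) == true :: t) && Q (count negb t)]| +
   #|stable_words false (Q \o S) n|)%N.
Proof.
rewrite /stable_words.
by rewrite (card_tuple_cons _ (fun t => (opening b t == t) && Q (count negb t))).
Qed.

Lemma card_stable_trueS Q n :
  #|stable_words true Q n.+1| =
  (#|stable_words true Q n| + #|stable_words false (Q \o S) n|)%N.
Proof.
by rewrite card_stable_cons; congr addn.
Qed.

(** After a false, an initial true must be followed by a second one, and then the rest is only
    required to be stable after true. *)
Lemma card_stable_falseSS Q n :
  #|stable_words false Q n.+2| =
  (#|stable_words true Q n| + #|stable_words false (Q \o S) n.+1|)%N.
Proof.
rewrite card_stable_cons; congr addn.
pose P w := (opening false (true :: w) == true :: w) && Q (count negb w).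
rewrite (card_tuple_cons _ P) /P.
rewrite [X in (_ + #|pred_of_set X|)%N](_ : _ = set0) ?cards0 ?addn0.
  by apply: eq_card => t; rewrite !inE !opening_stable_cons.
by apply/setP => t; rewrite !inE !opening_stable_cons.
Qed.

Lemma card_stable_false1 Q : #|stable_words false Q 1| = Q 1%N.
Proof.
rewrite card_stable_cons card_stable_false0.
rewrite [X in (#|pred_of_set X| + _)%N](_ : _ = set0) ?cards0 ?add0n //.
by apply/setP => t; rewrite !inE tuple0.
Qed.

Lemma card_stable_pred0 b n : #|stable_words b pred0 n| = 0%N.
Proof. by apply/eqP; rewrite cards_eq0; apply/eqP/setP => t; rewrite !inE andbF. Qed.

Lemma card_stable_true_all n : #|stable_words true (fun k => k == 0)%N n| = 1%N.
Proof.
elim: n => [|n IHn]; first exact: card_stable_true0.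
by rewrite card_stable_trueS IHn (card_stable_pred0 false).
Qed.

Lemma card_stable_false_all n :
  #|stable_words false (fun k => k == 0)%N n| = (n != 1)%N.
Proof.
case: n => [|[|n]]; rewrite ?card_stable_false0 ?card_stable_false1 //.
by rewrite card_stable_falseSS card_stable_true_all (card_stable_pred0 false).
Qed.

Lemma card_stable_true_one n :
  #|stable_words true (fun k => k == 1)%N n.+2| = n.+1.
Proof.
elim: n => [|n IHn]; rewrite card_stable_trueS; last first.
  by rewrite IHn card_stable_false_all addn1.
by rewrite card_stable_trueS card_stable_true0 !card_stable_false_all.
Qed.

(** Neither run of true around the false may have length 1. This forbids the second and the
    penultimate positions, which are distinct from length 4 on. *)
Lemma card_stable_false_one n :
  #|stable_words false (fun k => k == 1)%N n.+4| = n.+2.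
Proof.
by rewrite card_stable_falseSS card_stable_true_one card_stable_false_all addn1.
Qed.

Definition openings n : nat := #|stable_words false predT n|.

(** The recurrence results from eliminating the words counted after true between [AS] and [TS]. *)
Lemma openingsE :
  [/\ openings 0 = 1%N, openings 1 = 1%N, openings 2 = 2%N &
   forall n, (openings n.+3 + openings n.+1 = 2 * openings n.+2 + openings n)%N].
Proof.
have AS n : openings n.+2 = (#|stable_words true predT n| + openings n.+1)%N.
  exact: card_stable_falseSS.
have TS n : #|stable_words true predT n.+1| =
    (#|stable_words true predT n| + openings n)%N.
  exact: card_stable_trueS.
have A0 : openings 0 = 1%N by apply: card_stable_false0.
have A1 : openings 1 = 1%N by apply: card_stable_false1.
split=> // [|n]; first by rewrite AS A1 card_stable_true0.
by rewrite !AS TS; lia.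
Qed.

Lemma card_stable_neq1 n :
  (#|stable_words false (fun k => k == 1)%N n| +
   #|stable_words false (fun k => k != 1)%N n|)%N = openings n.
Proof.
rewrite -[RHS](cardsID [set t : n.-tuple bool | count negb t == 1%N]).
by congr addn; apply: eq_card => t; rewrite !inE ?andbT // andbC.
Qed.

(** * The generating function *)

Lemma sum_ord_support (R : nmodType) (F : nat -> R) m n :
  (m <= n)%N -> (forall i, (m <= i)%N -> F i = 0) ->
  \sum_(i < m) F i = \sum_(i < n) F i.
Proof.
move=> lemn F0; rewrite (big_ord_widen _ F lemn) big_mkcond.
by apply: eq_bigr => i _; case: ltnP => // /F0.
Qed.

(** The range of summation no longer depends on [n], so for a concrete [d] the sum can be
    unrolled. *)
Lemma series_mul_poly (R : nzRingType) (Q : {poly R}) (a : nat -> R) d n :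
  (size Q <= d)%N ->
  series_mul (fun i => Q`_i) a n = \sum_(i < d | (i <= n)%N) Q`_i * a (n - i)%N.
Proof.
move=> szQ; rewrite /series_mul [RHS]big_mkcond /=.
pose F i := if (i <= n)%N then Q`_i * a (n - i)%N else 0.
rewrite (eq_bigr (fun i : 'I_n.+1 => F i)) => [|i _]; last first.
  by rewrite /F -ltnS ltn_ord.
rewrite (@sum_ord_support _ F _ (n.+1 + d)) ?leq_addr //; last first.
  by move=> i ltni; rewrite /F leqNgt ltni.
rewrite -(@sum_ord_support _ F d) ?leq_addl // => i ledi.
by rewrite /F nth_default ?mul0r ?if_same // (leq_trans szQ).
Qed.

Theorem theorem14 :
  is_series_of_fraction (R := int)
    (fun n => #|FF_classes n|%:Z)
    (1 - 'X *+ 3 + 'X^2 *+ 4 - 'X^3 *+ 5 + 'X^4 *+ 7 - 'X^5 *+ 7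
       + 'X^6 *+ 6 - 'X^7 *+ 3 + 'X^8)
    ((1 - 'X *+ 2 + 'X^2 - 'X^3) * (1 - 'X) ^+ 2).
Proof.
(* An opaque [c] hides the cardinals from simplification and makes them atoms for [lia]. *)
have [c cP] : {c : nat -> nat | forall n, #|FF_classes n| = c n}.
  by exists (fun n => #|FF_classes n|).
have c0 : c 0%N = 1%N by rewrite -cP card_FF_classes // card_stable_false0.
have c1 : c 1%N = 1%N by rewrite -cP card_FF_classes1.
have c2 : c 2%N = 2%N.
  rewrite -cP card_FF_classes // card_stable_falseSS card_stable_true0.
  by rewrite card_stable_false1.
have c3 : c 3%N = 2%N.
  rewrite -cP card_FF_classes // !card_stable_falseSS card_stable_trueS.
  by rewrite !card_stable_true0 card_stable_false0 card_stable_false1.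
have cE n : (c n.+4 + n.+2 = openings n.+4)%N.
  by rewrite -cP card_FF_classes // -card_stable_neq1 card_stable_false_one addnC.
have [a0 a1 a2 aS] := openingsE.
set P := (P in is_series_of_fraction _ P _); set Q := _ * _.
have PE : P = Poly [:: 1; -3; 4; -5; 7; -7; 6; -3; 1].
  by rewrite /P /= !cons_poly_def !polyCN; ring.
have QE : Q = Poly [:: 1; -4; 6; -5; 3; -1].
  by rewrite /Q /= !cons_poly_def !polyCN; ring.
split; first by rewrite QE coef_Poly /= unitr1.
move=> n; rewrite (@series_mul_poly _ _ _ 6) ?QE ?size_Poly //.
rewrite big_mkcond !big_ord_recl big_ord0 PE !coef_Poly !cP.
have c4 : c 4%N = 5%N by move: (aS 0%N) (aS 1%N) (cE 0%N); lia.
have c5 : c 5%N = 9%N by move: (aS 0%N) (aS 1%N) (aS 2%N) (cE 1%N); lia.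
have c6 : c 6%N = 17%N by move: (aS 0%N) (aS 1%N) (aS 2%N) (aS 3%N) (cE 2%N); lia.
have c7 : c 7%N = 32%N.
  by move: (aS 0%N) (aS 1%N) (aS 2%N) (aS 3%N) (aS 4%N) (cE 3%N); lia.
have c8 : c 8%N = 59%N.
  by move: (aS 0%N) (aS 1%N) (aS 2%N) (aS 3%N) (aS 4%N) (aS 5%N) (cE 4%N); lia.
(* The numerator has degree 8, so the first nine coefficients are checked by value. *)
case: n => [|[|[|[|[|[|[|[|[|n]]]]]]]]]; rewrite !/bump /=;
  rewrite ?(c0, c1, c2, c3, c4, c5, c6, c7, c8) //.
rewrite nth_nil subn0 !subSS !subn0.
(* From degree 9 on the coefficient is 0: [(1 - 'X) ^+ 2] annihilates the linear correction in [cE],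
   and [r9 - 2 r8 + r7] annihilates the openings. *)
have e4 := cE n; have e5 := cE n.+1; have e6 := cE n.+2; have e7 := cE n.+3.
have e8 := cE n.+4; have e9 := cE n.+4.+1.
have r7 := aS n.+4; have r8 := aS n.+4.+1; have r9 := aS n.+4.+2.
lia.
Qed.
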